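(* Let $\lambda>0$ and $x>0$ be constants, and suppose $\overline Q\in\mathscr Q^+$. Then $\overline Q$ is an optimal solution to $\sup_{Q\in\mathscr Q^+}\mathcal L(Q)$ if and only if it satisfies \[\int_0^1\left[\frac{\partial V}{\partial x}(\overline Q(p),p)-\lambda Q_\rho(1-p)\right]\big(Q(p)-\overline Q(p)\big)\,dp\le0,\quad\forall\,Q\in\mathscr Q^+.\]
   Context: Quantiles. For a distribution function $G$, its quantile is $Q_G(p)=\inf\{z\in\mathbb R: G(z)>p\}$, $p\in(0,1)$ (right-continuous inverse), extended by limits to $p=0,1$; for a random variable $Y$ with distribution function $F_Y$, $Q_Y:=Q_{F_Y}$. $\mathscr Q^+$ is the set of all right-continuous non-decreasing functions $Q:(0,1)\to[0,\infty)$. Utility and claim. $u(x)=-\int_0^\infty e^{-\gamma x}\,dF(\gamma)$, $x\in\mathbb R$, where $F$ is a non-zero distribution function ($dF$ is a non-zero finite Borel measure, not necessarily of mass one) supported on a compact subset of $(0,\infty)$. $\vartheta$ is a random variable (the intractable claim) whose quantile $Q_\vartheta$ is Lipschitz continuous and differentiable on $[0,1]$ (so $\vartheta$ is bounded). For a fixed $\alpha\in[0,1]$, \[V(x,p)=(1-\alpha)u(x+Q_\vartheta(p))+\alpha u(x+Q_\vartheta(1-p)),\quad x\in\mathbb R,\ p\in(0,1).\] Pricing kernel. On a probability space with an $m$-dimensional standard Brownian motion $W$ and its augmented filtration $\{\mathcal F_t\}$, fix $T>0$ and progressively measurable $r$ (interest rate, bounded below) and $\theta$ (market price of risk, not identically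 zero, $\int_0^T|\theta(t)|^2dt<\infty$ a.s.) such that $Z(t)=\exp(-\int_0^t\theta(s)^\top dW(s)-\frac12\int_0^t|\theta(s)|^2ds)$ is a true martingale on $[0,T]$. Then $\rho=\exp\big(-\int_0^T(r(s)+\frac12|\theta(s)|^2)ds-\int_0^T\theta(s)^\top dW(s)\big)$; so $\rho>0$ and $\mathbb E[\rho]<\infty$. It is assumed that $Q_\rho$ is continuously differentiable, $Q_\rho(0)=0$ and $Q_\rho(1)=+\infty$. Lagrangian. $\mathcal L(Q)=\int_0^1\big[V(Q(p),p)-\lambda Q(p)Q_\rho(1-p)\big]dp+\lambda x$ for $Q\in\mathscr Q^+$. An optimal solution is a $\overline Q\in\mathscr Q^+$ attaining $\sup_{Q\in\mathscr Q^+}\mathcal L(Q)$. *)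

(* Defs.v *)
From HB Require Import structures.
From mathcomp Require Import all_boot all_order all_algebra.
From mathcomp Require Import all_classical all_reals all_analysis.
Set Implicit Arguments.
Unset Strict Implicit.
Unset Printing Implicit Defensive.
Import Order.TTheory GRing.Theory Num.Theory.
Import numFieldNormedType.Exports.
Local Open Scope classical_set_scope.
Local Open Scope ring_scope.

(** Quantiles *)

(* Right-continuous inverse on ]0, 1[, extended to the endpoints by limits,
   which may be infinite. *)
Definition equantile (R : realType) (G : R -> \bar R) (p : R) : \bar R :=
  let q (y : R) : R := inf [set z : R | (y%:E < G z)%E] in
  if p <= 0 then lim ((q y)%:E @[y --> 0^'+])
  else if 1 <= p then lim ((q y)%:E @[y --> 1^'-])
  else (q p)%:E.

(* The junk value fine (+oo) = 0 can only occur outside ]0, 1[. *)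
Definition quantile (R : realType) (G : R -> \bar R) (p : R) : R :=
  fine (equantile G p).

(* Only the values on ]0, 1[ of an element of Qplus are meaningful. *)
Definition Qplus (R : realType) : set (R -> R) :=
  [set Q : R -> R | [/\ forall p : R, 0 < p < 1 -> 0 <= Q p,
               forall p q : R, 0 < p -> p <= q -> q < 1 -> Q p <= Q q
             & forall p : R, 0 < p < 1 -> Q q @[q --> p^'+] --> Q p]].

(* Differentiability along A: one-sided at the endpoints of an interval. *)
Definition differentiable_along (R : realType) (A : set R) (f : R -> R) :=
  forall x, A x -> cvg ((f y - f x) / (y - x) @[y --> within A x^']).

(** Utility and Lagrangian *)

Definition utility (R : realType) (c : R) (F : cumulativeBounded (0 : R) c)
    (x : R) : R :=
  - \int[lebesgue_stieltjes_measure F]_(g in `[0, +oo[) expR (- g * x).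

(* The total mass c of dF is not assumed to be 1. *)
Definition admissible_utility (R : realType) (c : R)
    (F : cumulativeBounded (0 : R) c) :=
  (exists z, F z != 0) /\
  exists K : set R, [/\ compact K, K `<=` `]0, +oo[ &
    lebesgue_stieltjes_measure F (~` K) = 0%E].

Definition claim_utility (R : realType) (u qv : R -> R) (alpha x p : R) : R :=
  (1 - alpha) * u (x + qv p) + alpha * u (x + qv (1 - p)).

Definition Lagrangian (R : realType) (V : R -> R -> R) (qrho : R -> R)
    (lam x : R) (Q : R -> R) : \bar R :=
  ((\int[lebesgue_measure]_(p in `]0%R, 1%R[)
      (V (Q p) p - lam * Q p * qrho (1 - p))%:E) + (lam * x)%:E)%E.

Definition optimal_solution (R : realType) (L : (R -> R) -> \bar R)
    (Qbar : R -> R) :=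
  Qplus Qbar /\ L Qbar = ereal_sup [set L Q | Q in @Qplus R].

(** Market model on the time interval [0, T] *)

Record standard_brownian_motion (R : realType) (d : measure_display)
    (Omega : measurableType d) (P : probability Omega R) (m : nat)
    (W : 'I_m -> R -> Omega -> R) : Prop := {
  bm_measurable : forall i (t : R), 0 <= t -> measurable_fun setT (W i t) ;
  bm_start : {ae P, forall w, forall i, W i 0 w = 0} ;
  bm_continuous : {ae P, forall w, forall i,
    {within `[0, +oo[, continuous (fun t => W i t w)}} ;
  bm_gaussian : forall i (s t : R), 0 <= s -> s < t -> forall B, measurable B ->
    P [set w | B (W i t w - W i s w)] = normal_prob 0 (Num.sqrt (t - s)) B ;
  (* joint independence, over both time steps and coordinates *)
  bm_independent : forall (n : nat) (t : nat -> R), 0 <= t 0%N ->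
    (forall k, t k <= t k.+1) ->
    forall B : 'I_m -> nat -> set R, (forall i k, measurable (B i k)) ->
    fine (P [set w | forall i (k : 'I_n),
               B i k (W i (t k.+1) w - W i (t k) w)]) =
    \prod_(i < m) \prod_(k < n)
      fine (P [set w | B i k (W i (t k.+1) w - W i (t k) w)]) }.

Definition augmented_filtration (R : realType) (d : measure_display)
    (Omega : measurableType d) (P : probability Omega R) (m : nat)
    (W : 'I_m -> R -> Omega -> R) (t : R) : set (set Omega) :=
  <<s [set A | measurable A /\ P A = 0%E] `|`
      [set A | exists i (s : R) (B : set R),
         [/\ 0 <= s <= t, measurable B & A = W i s @^-1` B]] >>.

Definition adapted (R : realType) (Omega : Type) (F : R -> set (set Omega))
    (T : R) (X : R -> Omega -> R) :=
  forall t : R, 0 <= t <= T -> forall B : set R, measurable B ->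
    F t (X t @^-1` B).

Definition progressive (R : realType) (Omega : Type)
    (F : R -> set (set Omega)) (T : R) (X : R -> Omega -> R) :=
  forall t : R, 0 <= t <= T -> forall B : set R, measurable B ->
    <<s [set A `*` C | A in [set A : set R | measurable A] & C in F t] >>
      [set z : R * Omega | 0 <= z.1 <= t /\ B (X z.1 z.2)].

Definition martingale (R : realType) (d : measure_display)
    (Omega : measurableType d) (P : probability Omega R)
    (F : R -> set (set Omega)) (T : R) (X : R -> Omega -> R) :=
  [/\ adapted F T X,
      forall t : R, 0 <= t <= T -> P.-integrable setT (EFin \o X t)
    & forall s t : R, 0 <= s -> s <= t -> t <= T -> forall A, F s A ->
        (\int[P]_(w in A) (X t w)%:E = \int[P]_(w in A) (X s w)%:E)%E].

(* The step process sum_(k < n) xi_k 1_(t_k, t_k+1] with values in R^m *)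
Record step_process (R : realType) (Omega : Type) (m : nat) := StepProcess {
  step_size : nat ;
  step_time : nat -> R ;
  step_coef : 'I_m -> nat -> Omega -> R }.

Definition step_value (R : realType) (Omega : Type) (m : nat)
    (H : step_process R Omega m) (i : 'I_m) (s : R) (w : Omega) : R :=
  \sum_(k < step_size H)
    step_coef H i k w * \1_(`]step_time H k, step_time H k.+1]) s.

Definition step_integral (R : realType) (Omega : Type) (m : nat)
    (W : 'I_m -> R -> Omega -> R) (H : step_process R Omega m)
    (t : R) (w : Omega) : R :=
  \sum_(i < m) \sum_(k < step_size H) step_coef H i k w *
    (W i (Num.min t (step_time H k.+1)) w - W i (Num.min t (step_time H k)) w).

Definition simple_predictable (R : realType) (Omega : Type)
    (F : R -> set (set Omega)) (T : R) (m : nat)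
    (H : step_process R Omega m) :=
  [/\ 0 <= step_time H 0,
      forall k, (k < step_size H)%N -> step_time H k <= step_time H k.+1,
      step_time H (step_size H) <= T
    & forall i k, (k < step_size H)%N ->
        (exists M, forall w, `|step_coef H i k w| <= M) /\
        forall B : set R, measurable B ->
          F (step_time H k) (step_coef H i k @^-1` B)].

(* I(t) = int_0^t theta(s)^T dW(s) on [0, T]: the limit in probability of the
   integrals of simple predictable processes which approximate theta, in
   probability, in L^2([0, T]). This determines I up to indistinguishability. *)
Definition is_ito_integral (R : realType) (d : measure_display)
    (Omega : measurableType d) (P : probability Omega R)
    (F : R -> set (set Omega)) (T : R) (m : nat)
    (W theta : 'I_m -> R -> Omega -> R) (I : R -> Omega -> R) :=
  [/\ adapted F T I,
      {ae P, forall w, {within `[0, T], continuous (fun t => I t w)}}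
    & exists H : nat -> step_process R Omega m,
      [/\ forall n, simple_predictable F T (H n),
          forall e : R, 0 < e ->
            P [set w | (e%:E < \int[lebesgue_measure]_(s in `[0%R, T])
                 (\sum_(i < m)
                    (step_value (H n) i s w - theta i s w) ^+ 2)%:E)%E]
              @[n --> \oo] --> 0%E
        & forall t : R, 0 <= t <= T -> forall e : R, 0 < e ->
            P [set w | e < `|step_integral W (H n) t w - I t w| ]
              @[n --> \oo] --> 0%E]].

(* Euclidean norm squared *)
Definition sqnorm (R : realType) (Omega : Type) (m : nat)
    (theta : 'I_m -> R -> Omega -> R) (s : R) (w : Omega) : R :=
  \sum_(i < m) theta i s w ^+ 2.

Definition density_process (R : realType) (Omega : Type) (m : nat)
    (theta : 'I_m -> R -> Omega -> R) (I : R -> Omega -> R)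
    (t : R) (w : Omega) : R :=
  expR (- I t w - 2^-1 * \int[lebesgue_measure]_(s in `[0, t]) sqnorm theta s w).

(* r is only bounded below, so the time integral may be +oo, in which case
   the kernel is exp(-oo) = 0. *)
Definition pricing_kernel (R : realType) (Omega : Type) (m : nat) (T : R)
    (r : R -> Omega -> R) (theta : 'I_m -> R -> Omega -> R)
    (I : R -> Omega -> R) (w : Omega) : \bar R :=
  expeR (- (\int[lebesgue_measure]_(s in `[0%R, T])
              (r s w + 2^-1 * sqnorm theta s w)%:E) - (I T w)%:E)%E.

(* Main.v *)
(** Write the integrand of the Lagrangian as l(y, p) = V(y, p) - k(p) y with
    k(p) = lam Q_rho(1 - p) nonnegative and nonincreasing; V is concave in y and
    bounded on y >= 0, so the integral of l(Q) lies in [-oo, +oo[.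

    Necessity. If l(Q) is integrable, the difference quotients of l along the
    segment from Qbar to Q are bounded below by l(Q) - l(Qbar), and have
    nonpositive integral; Fatou's lemma yields the inequality. A general Q is the
    increasing limit of Q_n = min(Q, n) 1_{p >= 1/(n+1)}, for which k Q_n is
    bounded. With h the gradient of l at Qbar, h Q_n = t h Q with t in [0, 1] and
    h Qbar is integrable, so h (Q_n - Qbar) >= - (h (Q - Qbar))^- - |h Qbar|, and
    Fatou's lemma applies again unless the negative part has infinite integral.

    Sufficiency. By concavity l(Q) - l(Qbar) <= h (Q - Qbar). For Q = 0 this shows
    that l(Qbar) is integrable, and one then integrates the inequality. *)

Require Import Defs.
From HB Require Import structures.
From mathcomp Require Import all_boot all_order all_algebra.
From mathcomp Require Import all_classical all_reals all_analysis.
From mathcomp Require Import measurable_realfun ring lra.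
Set Implicit Arguments.
Unset Strict Implicit.
Unset Printing Implicit Defensive.
Import Order.TTheory GRing.Theory Num.Theory.
Import numFieldNormedType.Exports.
Local Open Scope classical_set_scope.
Local Open Scope ring_scope.

(** By monotonicity the preimage in [D] of an upper ray is an interval, and intervals are Borel. *)
Lemma measurable_nondecreasing_in (R : realType) (D : set R) (f : R -> R) :
  is_interval D -> (forall s t, D s -> D t -> s <= t -> f s <= f t) ->
  measurable_fun D f.
Proof.
move=> iD fD mD; apply: (measurability (@RGenCInfty.G R)).
  exact: RGenCInfty.measurableE.
move=> /= _ [_] [r] -> <-.
apply: is_interval_measurable => s t [Ds] /=.
rewrite !in_itv/= !andbT => rs [Dt rt] u /andP[su ut].
have Du : D u by apply: (iD s t) => //; rewrite su ut.
by split=> //=; rewrite in_itv/= andbT (le_trans rs)// fD.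
exact: mD.
Qed.

(** * Integrability from one-sided bounds, and Fatou's lemma *)

Section one_sided_bounds.
Context d (T : measurableType d) (R : realType).
Variables (mu : {measure set T -> \bar R}) (D : set T).
Hypothesis mD : measurable D.
Implicit Types f g psi : T -> R.

(** The lower bound makes the integral of the negative part finite, so the integral of [f] stays
    below [+oo] only if that of the positive part is finite too. *)
Lemma integrable_of_lower_bound f psi :
  measurable_fun D f -> mu.-integrable D (EFin \o psi) ->
  (forall x, D x -> psi x <= f x) ->
  (\int[mu]_(x in D) (f x)%:E < +oo)%E -> mu.-integrable D (EFin \o f).
Proof.
move=> mf ipsi psif foo.
have mEf : measurable_fun D (EFin \o f) by exact/measurable_EFinP.
have foon : (\int[mu]_(x in D) (EFin \o f)^\- x < +oo)%E.
  have /integrableP[_] := ipsi; apply: le_lt_trans.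
  apply: ge0_le_integral => //.
  - by apply/measurable_funeneg.
  - by apply: measurableT_comp => //; have /integrableP[] := ipsi.
  move=> x Dx; rewrite funenegE /= -EFin_max lee_fin ge_max normr_ge0 andbT.
  by rewrite -normrN (le_trans _ (ler_norm _))// lerN2 psif.
have foop : (\int[mu]_(x in D) (EFin \o f)^\+ x < +oo)%E.
  have : (0 <= \int[mu]_(x in D) (EFin \o f)^\- x)%E by exact: integral_ge0.
  move: foo foon; rewrite [X in (X < _)%E -> _ -> _](integralE _ _ (EFin \o f)).
  move: (\int[mu]_(x in D) (EFin \o f)^\- x)%E (\int[mu]_(x in D) (EFin \o f)^\+ x)%E.
  by move=> [a||] [b||] + a0 b0; rewrite ?ltry ?ltNyr// addye.
apply/integrableP; split=> //.
rewrite (_ : (fun x => _) = (EFin \o f)^\+ \+ (EFin \o f)^\-)%E; last first.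
  by rewrite -fune_abse.
rewrite ge0_integralD//; first exact: lte_add_pinfty.
- exact/measurable_funepos.
- exact/measurable_funeneg.
Qed.

Lemma integrable_of_upper_bound f psi :
  measurable_fun D f -> mu.-integrable D (EFin \o psi) ->
  (forall x, D x -> f x <= psi x) ->
  (-oo < \int[mu]_(x in D) (f x)%:E)%E -> mu.-integrable D (EFin \o f).
Proof.
move=> mf ipsi fpsi foo.
have mEf : measurable_fun D (EFin \o f) by exact/measurable_EFinP.
have foop : (\int[mu]_(x in D) (EFin \o f)^\+ x < +oo)%E.
  have /integrableP[_] := ipsi; apply: le_lt_trans.
  apply: ge0_le_integral => //.
  - by apply/measurable_funepos.
  - by apply: measurableT_comp => //; have /integrableP[] := ipsi.
  move=> x Dx; rewrite funeposE /= -EFin_max lee_fin ge_max normr_ge0 andbT.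
  by rewrite (le_trans _ (ler_norm _))// fpsi.
have iNf : mu.-integrable D (EFin \o (fun x => - f x)).
  apply: (@integrable_of_lower_bound _ (fun x => - psi x)).
  - exact: measurableT_comp.
  - rewrite (_ : EFin \o _ = -%E \o (EFin \o psi)); last first.
      by apply/funext => x /=; rewrite EFinN.
    exact: integrableN.
  - by move=> x Dx; rewrite lerN2 fpsi.
  (* Negation passes through the integral: the positive part has finite integral, so no difference
     of infinities arises. *)
  suff -> : (\int[mu]_(x in D) (- f x)%:E = - \int[mu]_(x in D) (EFin \o f) x)%E.
    by rewrite lteNl.
  rewrite -integralN; first by apply: eq_integral.
  apply/fin_num_adde_defr/fin_numPlt.
  by rewrite foop andbT (@lt_le_trans _ _ 0%E)// integral_ge0.
rewrite (_ : EFin \o f = -%E \o (EFin \o (fun x => - f x))).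
  exact: integrableN.
by apply/funext => x /=; rewrite opprK.
Qed.

Lemma integrable_between f psi1 psi2 : measurable_fun D f ->
  mu.-integrable D (EFin \o psi1) -> mu.-integrable D (EFin \o psi2) ->
  (forall x, D x -> psi1 x <= f x <= psi2 x) -> mu.-integrable D (EFin \o f).
Proof.
move=> mf i1 i2 H.
apply: (@le_integrable _ _ _ mu D mD _
  (EFin \o (fun x => `|psi1 x| + `|psi2 x|))).
- exact/measurable_EFinP.
- move=> x Dx /=; have /andP[l u] := H x Dx.
  rewrite lee_fin (ger0_norm (addr_ge0 (normr_ge0 _) (normr_ge0 _))) ler_norml.
  apply/andP; split.
    rewrite opprD (le_trans _ l)// (@le_trans _ _ (- `|psi1 x|))//.
      by rewrite gerDl oppr_le0.
    by rewrite lerNl -normrN ler_norm.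
  by rewrite (le_trans u)// (le_trans (ler_norm _))// lerDr.
- rewrite (_ : EFin \o _ =
    (EFin \o (Num.norm \o psi1)) \+ (EFin \o (Num.norm \o psi2)))%E//.
  by apply: integrableD => //; exact: integrable_norm.
Qed.

(** Fatou's lemma for the nonnegative [phi n - psi] bounds the integral of [g - psi] by the finite
    number [- int psi]. Hence [g - psi] is integrable, and adding [psi] back gives both
    conclusions. *)
Lemma fatou_integral_le0 (phi : nat -> T -> R) g psi :
  (forall n, mu.-integrable D (EFin \o phi n)) ->
  (forall n, \int[mu]_(x in D) (phi n x)%:E <= 0)%E ->
  mu.-integrable D (EFin \o psi) ->
  (forall n x, D x -> psi x <= phi n x) ->
  (forall x, D x -> phi ^~ x @ \oo --> g x) ->
  mu.-integrable D (EFin \o g) /\ (\int[mu]_(x in D) (g x)%:E <= 0)%E.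
Proof.
move=> iphi phi0 ipsi psiphi phig.
have mphi n : measurable_fun D (phi n).
  by apply/measurable_EFinP; have /integrableP[] := iphi n.
have mpsi : measurable_fun D psi.
  by apply/measurable_EFinP; have /integrableP[] := ipsi.
have mg : measurable_fun D g.
  exact: (measurable_fun_cvg mphi).
have psig x : D x -> psi x <= g x.
  move=> Dx; rewrite -(cvg_lim _ (phig x Dx))//.
  apply: limr_ge; first by apply/cvg_ex; exists (g x); exact: phig.
  by apply: nearW => n; exact: psiphi.
have h0 x : D x -> (0 <= (g x - psi x)%:E)%E.
  by move=> Dx; rewrite lee_fin subr_ge0 psig.
have intE n : (\int[mu]_(x in D) (phi n x - psi x)%:E =
    \int[mu]_(x in D) (phi n x)%:E - \int[mu]_(x in D) (psi x)%:E)%E.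
  exact: integralB_EFin.
have psifin := integrable_fin_num mD ipsi.
have hle : (\int[mu]_(x in D) (g x - psi x)%:E <=
    - \int[mu]_(x in D) (psi x)%:E)%E.
  have -> : (\int[mu]_(x in D) (g x - psi x)%:E = \int[mu]_(x in D)
      limn_einf (fun n => (phi n x - psi x)%:E))%E.
    apply: eq_integral => x /set_mem Dx; apply/esym.
    apply: (cvg_limn_einf_sup _).1; apply: cvg_EFin; first exact: nearW.
    by apply: cvgB; [exact: phig|exact: cvg_cst].
  apply: (le_trans (@fatou _ _ _ mu D mD
    (fun n x => (phi n x - psi x)%:E) _ _)).
  - by move=> n; apply/measurable_EFinP; exact: measurable_funB.
  - by move=> n x Dx; rewrite lee_fin subr_ge0 psiphi.
  rewrite limn_einf_lim; apply: lime_le; first exact: is_cvg_einfs.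
  apply: nearW => n; apply: (@le_trans _ _ (\int[mu]_(x in D) (phi n x - psi x)%:E)%E).
    by apply: ereal_inf_lbound; exists n => /=.
  by rewrite intE -[leRHS]add0e leeD2r.
have ih : mu.-integrable D (EFin \o (fun x => g x - psi x)).
  apply: (@integrable_of_lower_bound _ (cst 0)) => //.
  - exact: measurable_funB.
  - exact: integrable0.
  - by apply: (le_lt_trans hle); rewrite ltey_eq fin_numN psifin.
have gE : EFin \o g = (EFin \o (fun x => g x - psi x)) \+ (EFin \o psi).
  by apply/funext => x /=; rewrite -EFinD subrK.
split; first by rewrite gE; exact: integrableD.
rewrite -[X in (X <= _)%E]/(\int[mu]_(x in D) (EFin \o g) x)%E gE integralD//.
by rewrite -leeBrDr// add0e.
Qed.

End one_sided_bounds.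

(** * Convexity of [Qplus] and truncation of quantiles *)

Section Qplus_theory.
Variable R : realType.
Implicit Types (Q : R -> R) (p q t : R).

Lemma Qplus_cst0 : @Qplus R (cst 0).
Proof. by split=> // p _; exact: cvg_cst. Qed.

Lemma Qplus_convex Q1 Q2 t : 0 <= t <= 1 -> Qplus Q1 -> Qplus Q2 ->
  Qplus (fun p => Q1 p + t * (Q2 p - Q1 p)).
Proof.
move=> /andP[t0 t1] [Q10 Q1i Q1r] [Q20 Q2i Q2r].
have E p : Q1 p + t * (Q2 p - Q1 p) = (1 - t) * Q1 p + t * Q2 p by ring.
split=> [p pI|p q p0 pq q1|p pI].
- by rewrite E addr_ge0// mulr_ge0 ?subr_ge0// ?Q10 ?Q20.
- by rewrite !E lerD// ler_wpM2l ?subr_ge0// ?Q1i ?Q2i.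
- apply: cvgD; first exact: Q1r.
  by apply: cvgMr; apply: cvgB; [exact: Q2r|exact: Q1r].
Qed.

(* The cut-off near 0 is needed besides the one above: the price of a bounded
   quantile is controlled only away from 0, where the pricing kernel blows up. *)
Definition trunc_quantile Q (n : nat) p : R :=
  if p < n.+1%:R^-1 then 0 else Num.min (Q p) n%:R.

Lemma Qplus_trunc Q n : Qplus Q -> Qplus (trunc_quantile Q n).
Proof.
move=> [Q0 Qi Qr]; rewrite /trunc_quantile; split=> [p pI|p q p0 pq q1|p pI].
- by case: ifP => // _; rewrite le_min Q0//=.
- have q0 : 0 < q < 1 by rewrite (lt_le_trans p0 pq) q1.
  case: ifPn => pn; case: ifPn => qn //.
  + by rewrite le_min Q0//=.
  + by move: pn; rewrite -leNgt => /le_lt_trans => /(_ _ (le_lt_trans pq qn)); rewrite ltxx.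
  + by rewrite le_min !ge_min lexx orbT Qi.
(* The test against the cut-off is strict, so the cut-off point itself takes the upper branch; every
   point then keeps its branch on a right neighbourhood. *)
- case: ifPn => pn.
    apply: cvg_near_cst; near=> q.
    have qn : q < n.+1%:R^-1 by near: q; exact: nbhs_right_lt.
    by rewrite qn.
  have cm : Num.min (Q q) n%:R @[q --> p^'+] --> Num.min (Q p) n%:R.
    have cont : {for Q p, continuous ((@idfun R^o) \min cst n%:R)}.
      by apply: continuous_min => //; exact: cvg_cst.
    exact: (cvg_comp _ _ (Qr _ pI) cont).
  apply: cvg_trans cm; apply: near_eq_cvg; near=> q.
  have pq : p < q by near: q; exact: nbhs_right_gt.
  by rewrite ltNge (ltW (le_lt_trans _ pq))// leNgt.
Unshelve. all: by end_near. Qed.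

(** The sequence is eventually constant: it equals [Q p] once [n] is at least [Q p] and [p^-1]. *)
Lemma cvg_trunc_quantile Q p : 0 < p -> trunc_quantile Q n p @[n --> \oo] --> Q p.
Proof.
move=> p0; apply: cvg_near_cst; near=> n; rewrite /trunc_quantile.
have Qn : Q p <= n%:R by near: n; exact: nbhs_infty_ger.
have pn : p^-1 <= n%:R by near: n; exact: nbhs_infty_ger.
rewrite ltNge invf_ple ?posrE// (le_trans pn) ?ler_nat//=.
exact: min_l.
Unshelve. all: by end_near. Qed.

(** The factor [t] places a term affine in the truncation between its values at zero and at [Q],
    which yields a lower bound independent of [n] for Fatou's lemma. *)
Lemma trunc_quantileE Q n p : 0 <= Q p ->
  exists2 t, 0 <= t <= 1 & trunc_quantile Q n p = t * Q p.
Proof.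
rewrite /trunc_quantile le_eqVlt => /predU1P[<-|Qp0].
  exists 0; first by rewrite lexx ler01.
  by rewrite mul0r; case: ifP => // _; rewrite min_l.
case: ifP => _; first by exists 0; rewrite ?mul0r// lexx ler01.
exists (Num.min (Q p) n%:R / Q p); last by rewrite divfK// gt_eqF.
by rewrite divr_ge0 ?(ltW Qp0) ?le_min ?(ltW Qp0)//= ler_pdivrMr// mul1r ge_min lexx.
Qed.

Lemma Qplus_measurable Q : Qplus Q -> measurable_fun (`]0, 1[ : set R) Q.
Proof.
move=> [_ Qi _]; apply: measurable_nondecreasing_in => [|s t].
  exact: interval_is_interval.
by rewrite /= !in_itv/= => /andP[s0 _] /andP[_ t1] st; exact: Qi.
Qed.

End Qplus_theory.

(** Dividing by the parameter [n.+1^-1] of the segment from [y] to [z], not by the increment, keeps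
    the quotient meaningful for [z = y]. *)
Definition secant_slope (R : realType) (f : R -> R) (y z : R) (n : nat) : R :=
  (f (y + n.+1%:R^-1 * (z - y)) - f y) * n.+1%:R.

Lemma cvg_secant_slope (R : realType) (f : R -> R) (y z : R) :
  derivable f y 1 -> secant_slope f y z n @[n --> \oo] --> derive1 f y * (z - y).
Proof.
(* The derivative is a limit over a punctured neighbourhood of 0, so a sequence of increments must
   avoid 0; [z = y] is treated apart. *)
move=> fy; have [->|zy] := eqVneq z y.
  rewrite subrr mulr0; apply: cvg_near_cst; apply: nearW => n.
  by rewrite /secant_slope subrr mulr0 addr0 subrr mul0r.
have zy0 : z - y != 0 by rewrite subr_eq0.
pose h (n : nat) : R := n.+1%:R^-1 * (z - y).
have h0 : (forall n, h n != 0) /\ h n @[n --> \oo] --> 0.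
  split=> [n|]; first by rewrite mulf_neq0// invr_eq0.
  by rewrite -(mul0r (z - y)); apply: cvgMl; exact: cvg_harmonic.
have fh : h^-1 *: (f (h + y) - f y) @[h --> 0^'] --> derive1 f y.
  move: fy; rewrite /derivable /derive1.
  by under eq_fun do rewrite scaler1.
have /cvgr_dnbhsP/(_ h h0) hh := fh.
have -> : secant_slope f y z = fun n => (h n)^-1 *: (f (h n + y) - f y) * (z - y).
  apply/funext => n; rewrite /secant_slope /h /GRing.scale/= (addrC y).
  by rewrite invfM invrK; field.
exact: cvgMl.
Qed.

(** * The variational inequality for a concave integrand *)

Section variational_inequality.
Variables (R : realType) (V : R -> R -> R) (k : R -> R) (M : R).
Local Notation mu := (@lebesgue_measure R).
Local Notation D := (`]0%R, 1%R[%classic : set R).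
Hypothesis Vconcave : forall p y z t : R, 0 < p < 1 -> 0 <= y -> 0 <= z ->
  0 <= t <= 1 -> V y p + t * (V z p - V y p) <= V (y + t * (z - y)) p.
Hypothesis Vderivable : forall p y, 0 < p < 1 -> 0 <= y ->
  derivable (V ^~ p) y 1.
Hypothesis Vbounded : forall p y, 0 < p < 1 -> 0 <= y -> `|V y p| <= M.
Hypothesis Vmeasurable : forall Q, Qplus Q ->
  measurable_fun D (fun p => V (Q p) p).
Hypothesis k_ge0 : forall p, 0 < p < 1 -> 0 <= k p.
Hypothesis k_nonincreasing : forall p q, 0 < p -> p <= q -> q < 1 -> k q <= k p.

Let obj (Q : R -> R) p := V (Q p) p - k p * Q p.
Let grad (Q : R -> R) p := derive1 (V ^~ p) (Q p) - k p.

Let mD : @measurable _ (measurableTypeR R) D. Proof. exact: measurable_itv. Qed.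

Let DE p : D p -> 0 < p < 1. Proof. by rewrite /= in_itv. Qed.

Let integrable_const a : mu.-integrable D (EFin \o cst a).
Proof.
apply: measurable_bounded_integrable => //.
  have := @lebesgue_measure_itv R `]0, 1[; rewrite /= lte_fin ltr01 -EFinB.
  by move=> /(congr1 (fun a => a < +oo)%E); rewrite ltry => ->.
exact: bounded_cst.
Qed.

Let k_measurable : measurable_fun D k.
Proof.
rewrite (_ : k = (fun p => - - k p)); last by apply/funext => p; rewrite opprK.
apply: measurableT_comp => //.
apply: measurable_nondecreasing_in => [|s t]; first exact: interval_is_interval.
rewrite /= !in_itv/= => /andP[s0 _] /andP[_ t1] st.
by rewrite lerN2 k_nonincreasing.
Qed.

Let obj_measurable Q : Qplus Q -> measurable_fun D (obj Q).
Proof.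
move=> hQ; apply: measurable_funB; first exact: Vmeasurable.
by apply: measurable_funM => //; exact: Qplus_measurable.
Qed.

Let obj_le Q p : Qplus Q -> D p -> obj Q p <= M.
Proof.
move=> [Q0 _ _] /DE pI; rewrite /obj lerBlDr (@le_trans _ _ M)//.
  by rewrite (le_trans (ler_norm _))// Vbounded// Q0.
by rewrite lerDl mulr_ge0// ?k_ge0// Q0.
Qed.

Let obj_integrable Q : Qplus Q ->
  (-oo < \int[mu]_(p in D) (obj Q p)%:E)%E -> mu.-integrable D (EFin \o obj Q).
Proof.
move=> hQ; apply: (@integrable_of_upper_bound _ _ _ _ _ _ _ (cst M)) => //.
- exact: obj_measurable.
- by move=> p Dp; exact: obj_le.
Qed.

Let obj_integrable_bounded Q a : Qplus Q ->
  (forall p, D p -> k p * Q p <= a) -> mu.-integrable D (EFin \o obj Q).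
Proof.
move=> hQ kQ; apply: (@integrable_between _ _ _ _ _ _ _ (cst (- M - a)) (cst M)) => //.
  exact: obj_measurable.
move=> p Dp; rewrite obj_le// andbT lerD// ?lerN2 ?kQ//.
have [Q0 _ _] := hQ; have := Vbounded (DE Dp) (Q0 _ (DE Dp)).
by rewrite ler_norml => /andP[].
Qed.

Let obj_concave Q1 Q2 t p : Qplus Q1 -> Qplus Q2 -> 0 <= t <= 1 -> D p ->
  obj Q1 p + t * (obj Q2 p - obj Q1 p) <=
  obj (fun p => Q1 p + t * (Q2 p - Q1 p)) p.
Proof.
move=> [Q10 _ _] [Q20 _ _] t01 /DE pI; rewrite /obj.
have := Vconcave pI (Q10 _ pI) (Q20 _ pI) t01.
by move=> H; nra.
Qed.

Let quot Qb Q n p := secant_slope (fun y => V y p - k p * y) (Qb p) (Q p) n.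

Let invn_bound n : 0 <= (n.+1%:R^-1 : R) <= 1.
Proof. by rewrite invr_ge0 ler0n/= invf_le1// ler1n. Qed.

(** This is concavity at parameter [n.+1^-1], divided by that parameter; the bound does not depend
    on [n]. *)
Let quot_ge Qb Q n p : Qplus Qb -> Qplus Q -> D p ->
  obj Q p - obj Qb p <= quot Qb Q n p.
Proof.
move=> hQb hQ Dp; rewrite /quot /secant_slope.
rewrite -ler_pdivrMr// lerBrDl [_ / _]mulrC.
exact: (obj_concave hQb hQ (invn_bound n) Dp).
Qed.

Let quot_cvg Qb Q p : Qplus Qb -> D p ->
  quot Qb Q n p @[n --> \oo] --> grad Qb p * (Q p - Qb p).
Proof.
move=> [Qb0 _ _] /DE pI.
rewrite (_ : quot Qb Q ^~ p = fun n =>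
    secant_slope (V ^~ p) (Qb p) (Q p) n - k p * (Q p - Qb p)); last first.
  by apply/funext => n; rewrite /quot /secant_slope; field.
rewrite /grad mulrBl; apply: cvgB; last exact: cvg_cst.
by apply: cvg_secant_slope; apply: Vderivable => //; exact: Qb0.
Qed.

(** The bound [quot_ge] is uniform in [n], so it survives in the limit. *)
Let grad_tangent Qb Q p : Qplus Qb -> Qplus Q -> D p ->
  obj Q p - obj Qb p <= grad Qb p * (Q p - Qb p).
Proof.
move=> hQb hQ Dp; have c := @quot_cvg _ Q _ hQb Dp.
rewrite -(cvg_lim _ c)//; apply: limr_ge; first by apply/cvg_ex; eexists; exact: c.
by apply: nearW => n; exact: quot_ge.
Qed.

Let quot_measurable Qb Q n : Qplus Qb -> Qplus Q ->
  measurable_fun D (quot Qb Q n).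
Proof.
move=> hQb hQ; apply: measurable_funM => //; apply: measurable_funB.
  exact: (obj_measurable (Qplus_convex (invn_bound n) hQb hQ)).
exact: obj_measurable.
Qed.

(** Measurability comes from being a pointwise limit of measurable difference quotients. *)
Let grad_measurable Qb Q : Qplus Qb -> Qplus Q ->
  measurable_fun D (fun p => grad Qb p * (Q p - Qb p)).
Proof.
move=> hQb hQ.
apply: (measurable_fun_cvg (fun n => quot_measurable n hQb hQ)) => p Dp.
exact: quot_cvg.
Qed.

(* By concavity the difference quotients of the integrand dominate
   [obj Q - obj Qb], which makes Fatou's lemma applicable. *)
Let first_order_condition_finite Qb Q : Qplus Qb -> Qplus Q ->
  mu.-integrable D (EFin \o obj Qb) -> mu.-integrable D (EFin \o obj Q) ->
  (forall Q', Qplus Q' -> \int[mu]_(p in D) (obj Q' p)%:E <=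
     \int[mu]_(p in D) (obj Qb p)%:E)%E ->
  mu.-integrable D (EFin \o (fun p => grad Qb p * (Q p - Qb p))) /\
  (\int[mu]_(p in D) (grad Qb p * (Q p - Qb p))%:E <= 0)%E.
Proof.
move=> hQb hQ iQb iQ opt.
pose Qn n p := Qb p + n.+1%:R^-1 * (Q p - Qb p).
have hQn n : Qplus (Qn n) by exact: Qplus_convex.
have iQn n : mu.-integrable D (EFin \o obj (Qn n)).
  (* Concavity puts the integrand at [Qn n] above the chord [psi], and [M] bounds it from above. *)
  pose psi (p : R) := obj Qb p + n.+1%:R^-1 * (obj Q p - obj Qb p).
  have ipsi : mu.-integrable D (EFin \o psi).
    rewrite (_ : EFin \o psi = (EFin \o obj Qb) \+
      (fun p => n.+1%:R^-1%:E * ((EFin \o obj Q) \- (EFin \o obj Qb)) p))%E.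
      by apply: integrableD => //; apply: integrableZl => //; exact: integrableB.
    by apply/funext => p /=; rewrite EFinD EFinM EFinB.
  apply: (@integrable_between _ _ _ mu D mD _ psi (cst M)) => //.
    exact: obj_measurable.
  by move=> p Dp; rewrite obj_le// andbT; exact: obj_concave.
have quotE n : EFin \o quot Qb Q n =
    (fun p => n.+1%:R%:E * ((EFin \o obj (Qn n)) \- (EFin \o obj Qb)) p)%E.
  by apply/funext => p /=; rewrite -EFinB -EFinM mulrC.
apply: (@fatou_integral_le0 _ _ _ mu D mD (quot Qb Q) _
  (fun p => obj Q p - obj Qb p)) => //.
- move=> n; rewrite quotE; apply: integrableZl => //; exact: integrableB.
- move=> n; rewrite -[X in (X <= _)%E]/(\int[mu]_(p in D) (EFin \o quot Qb Q n) p)%E.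
  rewrite quotE integralZl//; last exact: integrableB.
  rewrite integralB// mule_ge0_le0// ?lee_fin//.
  by rewrite sube_le0; exact: opt.
- rewrite (_ : EFin \o _ = (EFin \o obj Q) \- (EFin \o obj Qb))%E//.
  exact: integrableB.
- by move=> n p Dp; exact: quot_ge.
- by move=> p Dp; exact: quot_cvg.
Qed.

Lemma maximizer_first_order_condition Qb Q : Qplus Qb -> Qplus Q ->
  (forall Q', Qplus Q' -> \int[mu]_(p in D) (obj Q' p)%:E <=
     \int[mu]_(p in D) (obj Qb p)%:E)%E ->
  (\int[mu]_(p in D) (grad Qb p * (Q p - Qb p))%:E <= 0)%E.
Proof.
move=> hQb hQ opt.
have i0 : mu.-integrable D (EFin \o obj (cst 0)).
  apply: (@obj_integrable_bounded _ 0); first exact: Qplus_cst0.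
  by move=> p _; rewrite mulr0.
(* Comparison with the zero quantile keeps the maximal value above [-oo]. *)
have iQb : mu.-integrable D (EFin \o obj Qb).
  apply: obj_integrable => //; apply: lt_le_trans (opt _ (@Qplus_cst0 R)).
  by rewrite ltNye; have /fin_numP[] := integrable_fin_num mD i0.
(* From the cut-off on, the nonincreasing [k] is at most its value there and the truncation is at
   most [n]; before it the cost vanishes. *)
have iT n : mu.-integrable D (EFin \o obj (trunc_quantile Q n)).
  apply: (@obj_integrable_bounded _ (k n.+1%:R^-1 * n%:R)); first exact: Qplus_trunc.
  move=> p /DE /[dup] pI /andP[p0 p1]; rewrite /trunc_quantile.
  case: ifPn => [_|]; last rewrite -leNgt => np.
    (* For [n = 0] the cut-off is the endpoint 1, where [k] has no assumed sign; there the factor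
       [n] makes the bound zero. *)
    rewrite mulr0; case: n => [|n]; first by rewrite mulr0.
    by rewrite mulr_ge0// k_ge0// invr_gt0 ltr0n/= invf_lt1 ?ltr1n.
  have [Q0 _ _] := hQ.
  rewrite ler_pM ?k_ge0// ?le_min ?Q0//= ?ge_min ?lexx ?orbT//.
  by rewrite k_nonincreasing// invr_gt0.
have [igb _] := first_order_condition_finite hQb (@Qplus_cst0 R) iQb i0 opt.
pose g (p : R) := grad Qb p * (Q p - Qb p).
pose gb (p : R) := grad Qb p * (0 - Qb p).
have mg : measurable_fun D g by exact: grad_measurable.
have mEg : measurable_fun D (EFin \o g) by exact/measurable_EFinP.
rewrite -[X in (X <= _)%E]/(\int[mu]_(p in D) (EFin \o g) p)%E.
have [gNy|gNy] := eqVneq (\int[mu]_(p in D) (EFin \o g) p)%E -oo%E.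
  by rewrite gNy leNye.
(* In [\bar R] adding [-oo] gives [-oo], even to [+oo]; an infinite negative part would thus give
   the integral the excluded value [-oo]. *)
have gneg : (\int[mu]_(p in D) (EFin \o g)^\- p < +oo)%E.
  rewrite ltey; apply: contraNneq gNy => gy; rewrite integralE gy.
  by rewrite addeNy.
pose gmin (p : R) := Num.min (g p) 0.
have igmin : mu.-integrable D (EFin \o gmin).
  apply/integrableP; split; first by apply/measurable_EFinP; exact: measurable_minr.
  apply: le_lt_trans gneg; apply: ge0_le_integral => //.
  - apply: measurableT_comp => //; apply/measurable_EFinP; exact: measurable_minr.
  - exact: measurable_funeneg.
  move=> p Dp; rewrite funenegE /= -EFin_max lee_fin /gmin.
  by rewrite ler0_norm ?ge_min ?lexx ?orbT// oppr_min oppr0.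
pose psi (p : R) := gmin p - `|gb p|.
have ipsi : mu.-integrable D (EFin \o psi).
  rewrite (_ : EFin \o psi = (EFin \o gmin) \- (EFin \o (Num.norm \o gb)))%E.
    by apply: integrableB => //; exact: integrable_norm.
  by apply/funext => p /=; rewrite EFinB.
pose phi n (p : R) := grad Qb p * (trunc_quantile Q n p - Qb p).
have phiP n := first_order_condition_finite hQb (Qplus_trunc n hQ) iQb (iT n) opt.
apply: (@fatou_integral_le0 _ _ _ mu D mD phi g psi _ _ _ _ _).2 => //.
- by move=> n; have [] := phiP n.
- by move=> n; have [] := phiP n.
- move=> n p Dp; have [Q0 _ _] := hQ.
  (* With this factor [phi n] is [t * g + (1 - t) * gb]; the first term is at least [gmin], the
     second at least minus the absolute value of [gb]. *)
  have [t /andP[t0 t1] tE] := trunc_quantileE n (Q0 _ (DE Dp)).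
  rewrite /psi /phi tE (_ : grad _ _ * _ = t * g p + (1 - t) * gb p); last first.
    by rewrite /g /gb; ring.
  rewrite lerD//.
    rewrite /gmin; have [gp|gp] := leP (g p) 0; first by rewrite ler_niMl.
    by rewrite mulr_ge0// ltW.
  rewrite (@le_trans _ _ (- ((1 - t) * `|gb p|)))//.
    by rewrite lerN2 ler_piMl// gerBl.
  by rewrite -mulrN ler_wpM2l ?subr_ge0// lerNl -normrN ler_norm.
- move=> p /DE /andP[p0 _]; apply: cvgMr; apply: cvgB; last exact: cvg_cst.
  exact: cvg_trunc_quantile.
Qed.

Lemma first_order_condition_maximizer Qb Q : Qplus Qb -> Qplus Q ->
  (forall Q', Qplus Q' ->
     \int[mu]_(p in D) (grad Qb p * (Q' p - Qb p))%:E <= 0)%E ->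
  (\int[mu]_(p in D) (obj Q p)%:E <= \int[mu]_(p in D) (obj Qb p)%:E)%E.
Proof.
move=> hQb hQ foc.
have hQ0 := @Qplus_cst0 R.
have i0 : mu.-integrable D (EFin \o obj (cst 0)).
  apply: (@obj_integrable_bounded _ 0) => //.
  by move=> p _; rewrite mulr0.
(* The tangent inequality makes [psi] a lower bound of the gradient term, and the condition keeps
   the integral of that term below [+oo]. *)
have ig Q' (psi : R -> R) : Qplus Q' -> mu.-integrable D (EFin \o psi) ->
    (forall p, D p -> psi p <= obj Q' p - obj Qb p) ->
    mu.-integrable D (EFin \o (fun p => grad Qb p * (Q' p - Qb p))).
  move=> hQ' ipsi psile.
  apply: (@integrable_of_lower_bound _ _ _ mu D mD _ psi) => //.
  - exact: grad_measurable.
  - by move=> p Dp; rewrite (le_trans (psile _ Dp))// grad_tangent.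
  - by apply: (le_lt_trans (foc _ hQ')); exact: ltry.
pose obj0 := obj (cst 0).
pose g0 (p : R) := grad Qb p * (0 - Qb p).
(* The condition tested with the zero quantile bounds the price of [Qb]. *)
have ig0 : mu.-integrable D (EFin \o g0).
  apply: (ig _ (fun p => obj0 p - M) hQ0).
    rewrite (_ : EFin \o _ = (EFin \o obj0) \- (EFin \o cst M))%E//.
    exact: integrableB.
  by move=> p Dp; rewrite lerD2l lerN2 obj_le.
have iQb : mu.-integrable D (EFin \o obj Qb).
  (* The tangent inequality for the zero quantile, read as a lower bound of [obj Qb]. *)
  pose psi (p : R) := obj0 p - g0 p.
  apply: (@integrable_between _ _ _ mu D mD _ psi (cst M)) => //.
  - exact: obj_measurable.
  - rewrite (_ : EFin \o psi = (EFin \o obj0) \- (EFin \o g0))%E//.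
    exact: integrableB.
  - move=> p Dp; rewrite obj_le// andbT /psi lerBlDr -lerBlDl.
    exact: (grad_tangent hQb hQ0 Dp).
(* A competitor of value [-oo] is beaten trivially; any other has an integrable integrand, and the
   two integrals may be subtracted. *)
have [->|QNy] := eqVneq (\int[mu]_(p in D) (obj Q p)%:E)%E -oo%E.
  by rewrite leNye.
have iQ : mu.-integrable D (EFin \o obj Q).
  by apply: obj_integrable => //; rewrite ltNye.
have iB : mu.-integrable D (EFin \o (fun p => obj Q p - obj Qb p)).
  rewrite (_ : EFin \o _ = (EFin \o obj Q) \- (EFin \o obj Qb))%E//.
  exact: integrableB.
rewrite -sube_le0.
rewrite -(integralB_EFin mD iQ iQb); apply: le_trans (foc _ hQ).
apply: le_integral => //; first exact: (ig _ _ hQ iB).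
by move=> p /set_mem Dp; rewrite lee_fin grad_tangent.
Qed.

End variational_inequality.

(** * Utility and quantiles *)

Section laplace_transform.
Variables (R : realType) (mu : {measure set (measurableTypeR R) -> \bar R}).
Variables (K : set R) (b : R).
Hypothesis mK : @measurable _ (measurableTypeR R) K.
Hypothesis K_bounded : forall g, K g -> 0 <= g <= b.
Hypothesis muK : (mu K < +oo)%E.

Let laplace (x : R) : R := \int[mu]_(g in K) expR (- g * x).

Let integrand_measurable x : measurable_fun K (fun g : R => expR (- g * x)).
Proof.
apply: (@measurable_funTS _ _ _ _ K); apply: measurableT_comp => //.
by apply: measurable_funM => //; exact: measurableT_comp.
Qed.

Let integrand_le x a g : `|x| <= a -> K g -> expR (- g * x) <= expR (b * a).
Proof.
move=> xa Kg; have /andP[g0 gb] := K_bounded Kg.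
rewrite ler_expR mulNr -mulrN (@le_trans _ _ (g * a))//.
  by rewrite ler_wpM2l// (le_trans _ xa)// -normrN ler_norm.
by rewrite ler_wpM2r// (le_trans _ xa).
Qed.

Lemma integrable_laplace x :
  mu.-integrable K (EFin \o (fun g : R => expR (- g * x))).
Proof.
apply: measurable_bounded_integrable => //; first exact: integrand_measurable.
exists (expR (b * `|x|)); split; first exact: num_real.
move=> N bN g Kg /=; rewrite ger0_norm ?expR_ge0// (le_trans _ (ltW bN))//.
exact: integrand_le.
Qed.

Lemma laplace_ge0 x : 0 <= laplace x.
Proof. by apply: Rintegral_ge0 => g _; exact: expR_ge0. Qed.

Lemma laplace_nonincreasing x y : x <= y -> laplace y <= laplace x.
Proof.
move=> xy; apply: le_Rintegral => //; try exact: integrable_laplace.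
move=> g Kg; have /andP[g0 _] := K_bounded Kg.
by rewrite ler_expR !mulNr lerN2 ler_wpM2l.
Qed.

Lemma laplace_convex y z t : 0 <= t <= 1 ->
  laplace (y + t * (z - y)) <= laplace y + t * (laplace z - laplace y).
Proof.
move=> /andP[t0 t1]; have i := integrable_laplace.
rewrite (_ : laplace y + _ = (1 - t) * laplace y + t * laplace z); last by ring.
rewrite /laplace -!RintegralZl// -RintegralD//; last 2 first.
- by have := integrableZl mK (1 - t) (i y); apply: eq_integrable.
- by have := integrableZl mK t (i z); apply: eq_integrable.
apply: le_Rintegral => //.
- rewrite (_ : EFin \o _ = (fun g => (1 - t)%:E * (EFin \o (fun g : R => expR (- g * y))) g
      + t%:E * (EFin \o (fun g : R => expR (- g * z))) g))%E//.
  by apply: integrableD => //; apply: integrableZl.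
- move=> g _.
  have := @convex_expR R (Itv01 t0 t1) (- g * z) (- g * y).
  rewrite !convRE /= /unstable.onem => H.
  rewrite [leRHS]addrC (le_trans _ H)//.
  by rewrite (_ : - g * _ = t * (- g * z) + (1 - t) * (- g * y))//; ring.
Qed.

(** Differentiation under the integral sign, with a constant dominating the derivative on []x - 1, x
    + 1[]; constants are integrable because [mu K] is finite. *)
Lemma derivable_laplace x : derivable laplace x 1.
Proof.
(* The absolute value of [b] keeps the bound nonnegative even if [K] is empty. *)
pose G : R := `|b| * expR (b * (`|x| + 1)).
have dexp (g y : R) : is_derive y 1 (fun x : R => expR (- g * x)) (- g * expR (- g * y)).
  by apply: is_derive_eq; rewrite /GRing.scale/= mulr1 mulrC.
have G0 : 0 <= G by rewrite mulr_ge0// expR_ge0.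
pose f (y : R) (g : measurableTypeR R) : R := expR (- (g : R) * y).
have := (@derivable_under_integral _ _ _ mu f K mK x
  (x - 1) (x + 1) _ _ _ (cst G)).
apply => //.
- by rewrite /= in_itv/= ltrBlDr ltrDl ltr01.
- by move=> y _; exact: integrable_laplace.
- apply: measurable_bounded_integrable => //; exact: bounded_cst.
- move=> y g; rewrite /= in_itv/= => /andP[xy yx] Kg.
  have /andP[g0 gb] := K_bounded Kg.
  rewrite partial1of2E derive_val normrM normrN (ger0_norm (expR_ge0 _)).
  rewrite ler_pM ?expR_ge0// ?(ger0_norm g0) ?(le_trans gb) ?ler_norm//.
  apply: integrand_le => //.
  rewrite -(subrK x y) (le_trans (ler_normD _ _))// addrC lerD2l ler_norml.
  by apply/andP; split; lra.
Qed.

End laplace_transform.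

(** * Monotonicity and sign of quantiles *)

Section quantile_theory.
Context d (Omega : measurableType d) (R : realType) (P : probability Omega R).
Implicit Types (X : {RV P >-> R}) (p q : R).

Lemma quantileE (G : R -> \bar R) p : 0 < p < 1 ->
  quantile G p = inf [set z | (p%:E < G z)%E].
Proof. by move=> /andP[p0 p1]; rewrite /quantile /equantile !leNgt p0 p1. Qed.

(** The superlevel sets of the distribution function shrink as the level grows. Comparing infima
    also needs the set at level [q] nonempty and the one at level [p] bounded below; this follows
    from the limits 1 and 0 at infinity. *)
Lemma quantile_cdf_nondecreasing X p q : 0 < p -> p <= q -> q < 1 ->
  quantile (cdf X) p <= quantile (cdf X) q.
Proof.
move=> p0 pq q1.
rewrite !quantileE ?p0 ?q1 ?(le_lt_trans pq q1) ?(lt_le_trans p0 pq)//.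
have [z zq] : exists z, (q%:E < cdf X z)%E.
  have := cvg_cdfy1 X => /(_ [set y | q%:E < y]%E) [].
    by apply: open_ereal_gt'; rewrite lte_fin.
  by move=> z [_ /(_ (z + 1))] H; exists (z + 1); apply: H; rewrite ltrDl.
have [z0 zp] : exists z, (cdf X z < p%:E)%E.
  have := cvg_cdfNy0 X => /(_ [set y | y < p%:E]%E) [].
    by apply: open_ereal_lt'; rewrite lte_fin.
  by move=> y [_ /(_ (y - 1))] H; exists (y - 1); apply: H; rewrite ltrBlDr ltrDl.
apply: lb_le_inf; first by exists z.
move=> y /= qy; apply: ge_inf; last by apply: le_lt_trans qy; rewrite lee_fin.
exists z0 => w /= pw; rewrite leNgt; apply/negP => wz.
have := lt_trans zp pw; rewrite ltNge => /negP; apply.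
by apply: cdf_nondecreasing; exact: ltW.
Qed.

(** The distribution function vanishes on negative reals, so its superlevel set contains none; on an
    empty set [inf] takes the default value 0. *)
Lemma quantile_cdf_ge0 X p : {ae P, forall w, 0 <= X w} -> 0 < p < 1 ->
  0 <= quantile (cdf X) p.
Proof.
move=> [N [mN PN XN]] pI; rewrite quantileE//.
have [->|/set0P S0] := eqVneq [set z | (p%:E < cdf X z)%E] set0; first by rewrite inf0.
apply: lb_le_inf => // z /= pz; rewrite leNgt; apply/negP => z0.
move: pz; apply/negP; rewrite -leNgt (@le_trans _ _ 0%E)//; last first.
  by rewrite lee_fin ltW//; case/andP: pI.
rewrite -PN /cdf /distribution /pushforward.
apply: (le_measure P); rewrite ?inE//.
  exact: measurable_funPTI.
move=> w /=; rewrite in_itv/= => Xz; apply: XN => /= X0.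
by move: (le_lt_trans (le_trans X0 Xz) z0); rewrite ltxx.
Qed.

End quantile_theory.

(** * Sign, monotonicity, concavity and derivability of the utility *)

Section utility_theory.
Variables (R : realType) (c : R) (F : cumulativeBounded (0 : R) c).
Hypothesis hF : admissible_utility F.

(* The mass of [dF] outside the compact support is negligible, so the utility
   is minus the Laplace transform of a finite measure with bounded support. *)
Lemma utility_laplace : exists K b, [/\ @measurable _ (measurableTypeR R) K,
  forall g, K g -> 0 <= g <= b, (lebesgue_stieltjes_measure F K < +oo)%E &
  forall x, utility F x =
    - \int[lebesgue_stieltjes_measure F]_(g in K) expR (- g * x)].
Proof.
have [_ [K [cK K0 FK]]] := hF.
have mK : @measurable _ (measurableTypeR R) K by exact: compact_measurable.
have [N [_ /(_ (N + 1))]] := compact_bounded cK.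
rewrite ltrDl ltr01 => /(_ isT) KN.
have Kb g : K g -> 0 <= g <= N + 1.
  move=> Kg; have := K0 _ Kg; rewrite /= in_itv/= andbT => /ltW -> /=.
  exact: le_trans (ler_norm _) (KN _ Kg).
exists K, (N + 1); split=> //.
  (* The sign of [N + 1] is not known beforehand; if it is negative, [K] is empty. *)
  have [N0|N0] := leP 0 (N + 1); last first.
    have -> : K = set0; last by rewrite measure0.
    rewrite -subset0 => g /Kb /andP[g0 /(le_trans g0)].
    by rewrite leNgt N0.
  (* The measure is explicit on half-open intervals, and the left endpoint -1 leaves room for points
     of [K] known only to be nonnegative. *)
  have : (lebesgue_stieltjes_measure F `](-1)%R, (N + 1)%R] < +oo)%E.
    rewrite /lebesgue_stieltjes_measure /measure_extension.
    rewrite measurable_mu_extE/=; last exact: is_ocitv.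
    by rewrite wlength_itv_bnd ?ltry// (le_trans _ N0)// oppr_le0.
  apply: le_lt_trans; apply: le_measure; rewrite ?inE//.
  move=> g /Kb /andP[g0 gN]; rewrite /= in_itv/= gN andbT.
  by rewrite (lt_le_trans _ g0)// oppr_lt0.
move=> x; rewrite /utility /Rintegral; congr (- fine _).
etransitivity.
  have mNK : @measurable _ (measurableTypeR R) (~` K) by exact: measurableC.
  pose f (g : measurableTypeR R) : \bar R := (expR (- (g : R) * x))%:E.
  apply: (@ge0_negligible_integral _ (measurableTypeR R) R
    (lebesgue_stieltjes_measure F) _ (~` K) f mNK) => //.
  - apply/measurable_EFinP; apply: measurableT_comp => //.
    by apply: measurable_funM => //; exact: measurableT_comp.
  - by move=> g _; rewrite lee_fin expR_ge0.
congr integral; rewrite setDE setCK; apply/seteqP; split=> [g []//|g Kg].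
by split=> //; rewrite /= in_itv/= andbT; case/andP: (Kb _ Kg).
Qed.

Lemma utility_le0 x : utility F x <= 0.
Proof.
have [K [b [_ _ _ ->]]] := utility_laplace.
by rewrite oppr_le0; exact: laplace_ge0.
Qed.

Lemma utility_nondecreasing x y : x <= y -> utility F x <= utility F y.
Proof.
have [K [b [mK Kb FK E]]] := utility_laplace => xy.
by rewrite !E lerN2; exact: (laplace_nonincreasing mK Kb FK).
Qed.

Lemma utility_concave y z t : 0 <= t <= 1 ->
  utility F y + t * (utility F z - utility F y) <= utility F (y + t * (z - y)).
Proof.
have [K [b [mK Kb FK E]]] := utility_laplace => t01; rewrite !E.
have := laplace_convex mK Kb FK y z t01; rewrite -lerN2; apply: le_trans.
by rewrite opprD -mulrN opprD.
Qed.

Lemma derivable_utility x : derivable (utility F) x 1.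
Proof.
have [K [b [mK Kb FK /funext ->]]] := utility_laplace.
by apply: derivableN; exact: (derivable_laplace mK Kb FK).
Qed.

End utility_theory.

(** Comparison with the value at 0. The Lipschitz property is given for all constants above some
    [N], whence the choice [N + 1]. *)
Lemma lipschitz_itvcc_bounded (R : realType) (f : R -> R) :
  [lipschitz f p | p in `[0, 1]] -> exists B, forall p, 0 < p < 1 -> `|f p| <= B.
Proof.
move=> [N [_ /(_ (N + 1))]]; rewrite ltrDl ltr01 => /(_ isT) fN.
exists (`|f 0| + `|N + 1|) => p /andP[p0 p1].
rewrite -(subrK (f 0) (f p)) (le_trans (ler_normD _ _))// addrC lerD2l.
have := fN (p, 0) => /=; rewrite !in_itv/= !lexx !ler01 (ltW p0) (ltW p1) subr0.
move=> /(_ (conj isT isT)) /le_trans; apply.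
rewrite (ger0_norm (ltW p0)) (@le_trans _ _ (`|N + 1| * p))//.
  by rewrite ler_wpM2r ?(ltW p0)// ler_norm.
by rewrite ler_piMr// ltW.
Qed.

(** * Properties of the claim-adjusted utility inherited from [u] *)

Section claim_utility_theory.
Variables (R : realType) (u q : R -> R) (alpha : R).
Hypothesis alpha01 : 0 <= alpha <= 1.
Hypothesis u_le0 : forall x, u x <= 0.
Hypothesis u_nondecreasing : forall x y, x <= y -> u x <= u y.
Hypothesis u_concave : forall y z t : R, 0 <= t <= 1 ->
  u y + t * (u z - u y) <= u (y + t * (z - y)).
Hypothesis u_derivable : forall x : R, derivable u x 1.

Local Notation V := (claim_utility u q alpha).

Lemma claim_utility_concave p y z t : 0 <= t <= 1 ->
  V y p + t * (V z p - V y p) <= V (y + t * (z - y)) p.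
Proof.
move=> t01; have /andP[a0 a1] := alpha01.
have H r := u_concave (y + r) (z + r) t01.
have E r : y + r + t * (z + r - (y + r)) = y + t * (z - y) + r by ring.
have := lerD (ler_wpM2l (_ : 0 <= 1 - alpha) (H (q p)))
  (ler_wpM2l a0 (H (q (1 - p)))).
rewrite subr_ge0 => /(_ a1); rewrite !E; apply: le_trans.
by rewrite /claim_utility le_eqVlt; apply/orP; left; apply/eqP; ring.
Qed.

Lemma derivable_claim_utility p y : derivable (V ^~ p) y 1.
Proof.
have H r : derivable (fun x => u (x + r)) y 1.
  have := @u_derivable (y + r); rewrite /derivable.
  by under eq_fun do rewrite /= addrA.
by apply: derivableD; apply: derivableZ.
Qed.

(** For [y >= 0] both arguments of [u] are at least [- B], so both values lie between [u (- B)] and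
    0, and [V] is a convex combination of them. *)
Lemma claim_utility_bounded B p y : 0 <= y -> `|q p| <= B -> `|q (1 - p)| <= B ->
  `|V y p| <= - u (- B).
Proof.
move=> y0 qB qB'; have /andP[a0 a1] := alpha01.
have H r : `|r| <= B -> u (- B) <= u (y + r) <= 0.
  rewrite ler_norml => /andP[Br _]; rewrite u_le0// andbT.
  by apply: u_nondecreasing => //; rewrite (le_trans Br)// lerDr.
have /andP[l1 u1] := H _ qB; have /andP[l2 u2] := H _ qB'.
have a1' : 0 <= 1 - alpha by rewrite subr_ge0.
rewrite /claim_utility ler_norml opprK; apply/andP; split.
  rewrite (_ : u (- B) =
    (1 - alpha) * u (- B) + alpha * u (- B)); last by ring.
  by rewrite lerD// ler_wpM2l.
rewrite (@le_trans _ _ 0)// ?oppr_ge0 ?u_le0//.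
by rewrite -[leRHS]addr0 lerD// mulr_ge0_le0.
Qed.

Lemma claim_utility_measurable (D : set R) (Q : R -> R) :
  measurable_fun D Q -> measurable_fun D q ->
  measurable_fun D (fun p => q (1 - p)) ->
  measurable_fun D (fun p => V (Q p) p).
Proof.
move=> mQ mq mq'.
have mu : measurable_fun setT u.
  apply: nondecreasing_measurable => // x y; exact: u_nondecreasing.
apply: measurable_funD; apply: measurable_funM => //.
  by apply: (measurableT_comp mu); exact: measurable_funD.
by apply: (measurableT_comp mu); exact: measurable_funD.
Qed.

End claim_utility_theory.

(** * Optimality and the variational inequality *)

Lemma optimal_solutionP (R : realType) (L : (R -> R) -> \bar R) (Q : R -> R) :
  Qplus Q -> optimal_solution L Q <-> forall Q', Qplus Q' -> (L Q' <= L Q)%E.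
Proof.
move=> hQ; rewrite /optimal_solution; split=> [[_ ->] Q' hQ'|H].
  by apply: ereal_sup_ubound; exists Q'.
split=> //; apply/eqP; rewrite eq_le ereal_sup_ubound/=; last by exists Q.
by apply: ge_ereal_sup => _ [Q' hQ' <-]; exact: H.
Qed.

Unset Implicit Arguments.

Theorem proposition3p5 (R : realType) (d : measure_display)
    (Omega : measurableType d) (P : probability Omega R)
    (* utility *)
    (c : R) (F : cumulativeBounded (0 : R) c) (hF : admissible_utility F)
    (* intractable claim *)
    (vtheta : {RV P >-> R})
    (hvtheta_lip : [lipschitz quantile (cdf vtheta) p | p in `[0, 1]])
    (hvtheta_diff : differentiable_along `[0, 1] (quantile (cdf vtheta)))
    (alpha : R) (halpha : 0 <= alpha <= 1)
    (* market; Iw is the stochastic integral of theta with respect to W *)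
    (m : nat) (W : 'I_m -> R -> Omega -> R)
    (hW : standard_brownian_motion P W)
    (T : R) (hT : 0 < T)
    (r : R -> Omega -> R)
    (hr : progressive (augmented_filtration P W) T r)
    (hr_lb : exists b : R, forall (t : R) w, 0 <= t <= T -> b <= r t w)
    (theta : 'I_m -> R -> Omega -> R)
    (htheta : forall i, progressive (augmented_filtration P W) T (theta i))
    (htheta_neq0 : exists i (t : R) w, 0 <= t <= T /\ theta i t w != 0)
    (htheta_sq : {ae P, forall w,
       (\int[lebesgue_measure]_(s in `[0%R, T]) (sqnorm theta s w)%:E < +oo)%E})
    (Iw : R -> Omega -> R)
    (hIw : is_ito_integral P (augmented_filtration P W) T W theta Iw)
    (hZ : martingale P (augmented_filtration P W) T (density_process theta Iw))
    (* pricing kernel *)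
    (rho : {RV P >-> R})
    (hrho : {ae P, forall w, (rho w)%:E = pricing_kernel T r theta Iw w})
    (hrho_derivable : forall p : R, 0 < p < 1 ->
       derivable (quantile (cdf rho)) p 1)
    (hrho_C1 : {within `]0, 1[, continuous (derive1 (quantile (cdf rho)))})
    (hrho0 : equantile (cdf rho) 0 = 0%E)
    (hrho1 : equantile (cdf rho) 1 = +oo%E)
    (* multiplier, initial endowment and candidate *)
    (lam x : R) (hlam : 0 < lam) (hx : 0 < x)
    (Qbar : R -> R) (hQbar : Qplus Qbar) :
  (* +oo - +oo = -oo in \bar R: a Q for which the integral below is ill-defined
     imposes no condition on Qbar. *)
  let V := claim_utility (utility F) (quantile (cdf vtheta)) alpha in
  let qrho := quantile (cdf rho) in
  optimal_solution (Lagrangian V qrho lam x) Qbar <->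
  forall Q : R -> R, Qplus Q ->
    (\int[lebesgue_measure]_(p in `]0%R, 1%R[)
       ((derive1 (fun y => V y p) (Qbar p) - lam * qrho (1 - p))
          * (Q p - Qbar p))%:E <= 0)%E.

Proof.
pose qv := quantile (cdf vtheta).
move=> V qrho.
have one_minus (p : R) : 0 < p < 1 -> 0 < 1 - p < 1.
  by rewrite subr_gt0 ltrBlDr ltrDl andbC.
have [B qvB] := lipschitz_itvcc_bounded hvtheta_lip.
pose k p := lam * qrho (1 - p).
have rho_ge0 : {ae P, forall w, 0 <= rho w}.
  apply: filterS hrho => w rhow.
  by rewrite -lee_fin rhow /pricing_kernel expeR_ge0.
have k_ge0 p : 0 < p < 1 -> 0 <= k p.
  by move=> pI; rewrite mulr_ge0 ?(ltW hlam)// quantile_cdf_ge0// one_minus.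
have k_ni p q : 0 < p -> p <= q -> q < 1 -> k q <= k p.
  move=> p0 pq q1; rewrite ler_wpM2l ?(ltW hlam)// quantile_cdf_nondecreasing//.
  - by rewrite subr_gt0.
  - by rewrite lerD2l lerN2.
  - by rewrite ltrBlDr ltrDl.
have mqv : measurable_fun (`]0, 1[ : set R) qv.
  apply: measurable_nondecreasing_in => [|s t]; first exact: interval_is_interval.
  rewrite /= !in_itv/= => /andP[s0 _] /andP[_ t1] st.
  exact: quantile_cdf_nondecreasing.
have mqv' : measurable_fun (`]0, 1[ : set R) (fun p => qv (1 - p)).
  (* The reflected quantile is nonincreasing, so the monotone criterion is applied to its
     opposite. *)
  rewrite (_ : (fun p => _) = (fun p => - - qv (1 - p))); last first.
    by apply/funext => p; rewrite opprK.
  apply: measurableT_comp => //.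
  apply: measurable_nondecreasing_in => [|s t]; first exact: interval_is_interval.
  rewrite /= !in_itv/= => /andP[s0 _] /andP[_ t1] st.
  rewrite lerN2 quantile_cdf_nondecreasing ?subr_gt0 ?lerD2l ?lerN2//.
  by rewrite ltrBlDr ltrDl.
have Vconcave (p y z t : R) : 0 < p < 1 -> 0 <= y -> 0 <= z -> 0 <= t <= 1 ->
    V y p + t * (V z p - V y p) <= V (y + t * (z - y)) p.
  by move=> _ _ _; apply: claim_utility_concave => //; exact: utility_concave.
have Vderivable (p y : R) : 0 < p < 1 -> 0 <= y -> derivable (V ^~ p) y 1.
  by move=> _ _; apply: derivable_claim_utility => w; exact: derivable_utility.
have Vbounded (p y : R) : 0 < p < 1 -> 0 <= y -> `|V y p| <= - utility F (- B).
  move=> pI y0; apply: claim_utility_bounded => //.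
  - exact: utility_le0.
  - exact: utility_nondecreasing.
  - exact: qvB.
  - by apply: qvB; exact: one_minus.
have Vmeasurable Q : Qplus Q ->
    measurable_fun (`]0, 1[ : set R) (fun p => V (Q p) p).
  move=> hQ; apply: claim_utility_measurable => //.
  - exact: utility_nondecreasing.
  - exact: Qplus_measurable.
(* The constant [lam * x] is finite, so it cancels when Lagrangians are compared in [\bar R]. *)
have LE Q : Lagrangian V qrho lam x Q =
    (\int[lebesgue_measure]_(p in `]0%R, 1%R[) (V (Q p) p - k p * Q p)%:E
     + (lam * x)%:E)%E.
  rewrite /Lagrangian; congr (_ + _)%E; apply: eq_integral => p _.
  by rewrite /k mulrAC.
rewrite optimal_solutionP//; split=> [opt Q hQ|foc Q hQ].
- apply: (maximizer_first_order_condition Vconcave Vderivable Vbounded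
    Vmeasurable k_ge0 k_ni) => // Q' hQ'.
  by have := opt _ hQ'; rewrite !LE leeD2rE.
- rewrite !LE leeD2rE//.
  exact: (first_order_condition_maximizer Vconcave Vderivable Vbounded
    Vmeasurable k_ge0 k_ni).
Qed.
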